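(* For every integer $e\ge1$, the annihilator ideal in $\mathbb{Z}_{(2)}[u]$ of the element $[0,0]\in M_e$ is precisely $$I_e=\bigl(2^e,\ 2^{e-1}u^{3\cdot 2^0-2},\ 2^{e-2}u^{3\cdot2-2},\ 2^{e-3}u^{3\cdot2^2-2},\ \ldots,\ 2^{1}u^{3\cdot2^{e-2}-2},\ u^{3\cdot2^{e-1}-2}\bigr),$$ that is, the ideal generated by $2^e$ and the elements $2^{e-k}u^{3\cdot 2^{k-1}-2}$ for $1\le k\le e$.
   Context: Let $ku_*=\mathbb{Z}_{(2)}[u]$ with $|u|=2$ (coefficients of 2-primary connective complex $K$-homology). Let $L_{2^e}=L^\infty(2^e)=B(\mathbb{Z}/2^e)$ be the infinite-dimensional lens space. Define $M_e:=ku_*(\Sigma^{-1}L_{2^e})\otimes_{ku_*}ku_*(\Sigma^{-1}L_{2^e})$. Explicitly, $M_e$ is the graded $ku_*$-module generated by classes $[i,j]$, $i,j\ge0$, of grading $2i+2j$, with defining relations $$\sum_{\ell=0}^i\binom{2^e}{\ell+1}u^\ell[i-\ell,j]=0\quad\text{and}\quad \sum_{\ell=0}^j\binom{2^e}{\ell+1}u^\ell[i,j-\ell]=0\qquad (i,j\ge0).$$ *)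

(* Defs.v *)
From HB Require Import structures.
From mathcomp Require Import all_boot all_order all_algebra.
From mathcomp Require Import boolp.
From mathcomp Require Import monalg.

Set Implicit Arguments.
Unset Strict Implicit.
Unset Printing Implicit Defensive.

Import GRing.Theory Num.Theory.
Local Open Scope ring_scope.
Local Open Scope quotient_scope.

Definition odd_den : {pred rat} := [pred x | odd `|denq x|%N].

Lemma odd_denP (x : rat) :
  reflect (exists (d : nat) (n : int), odd d /\ x * d%:R = n%:~R)
          (x \in odd_den).
Proof.
apply: (iffP idP) => [ox|[d [n [od xdE]]]].
  exists `|denq x|%N, (numq x); split=> //.
  rewrite -[_%:R]/((`|denq x|%N : int)%:~R) absz_denq.
  by rewrite -{1}[x]divq_num_den divfK // intr_eq0 denq_neq0.
have {xdE}-> : x = n%:~R / (d : int)%:~R.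
  by rewrite -xdE mulfK // pnatr_eq0 -lt0n odd_gt0.
have : odd `|d : int| by [].
rewrite inE; case: divqP => [d0|k y _]; first by case: (d) d0 od.
by rewrite abszM oddM => /andP[].
Qed.

Lemma odd_den_subring_closed : GRing.subring_closed odd_den.
Proof.
split=> [|x y /odd_denP[d [n [od dE]]] /odd_denP[d' [n' [od' dE']]]
         |x y /odd_denP[d [n [od dE]]] /odd_denP[d' [n' [od' dE']]]].
- by rewrite inE.
- apply/odd_denP; exists (d * d')%N, (n * d' - n' * d).
  rewrite oddM od od'; split=> //.
  by rewrite natrM rmorphB !rmorphM /= -dE -dE' mulrBl mulrA (mulrC d%:R) mulrA.
- apply/odd_denP; exists (d * d')%N, (n * n').
  by rewrite oddM od od'; split=> //; rewrite natrM rmorphM /= -dE -dE' mulrACA.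
Qed.

HB.instance Definition _ :=
  GRing.isSubringClosed.Build rat odd_den odd_den_subring_closed.

(* The localization of the integers at the prime ideal (2). *)
Record Z2loc := MkZ2loc { Z2loc_val :> rat; _ : Z2loc_val \in odd_den }.

HB.instance Definition _ := [isSub for Z2loc_val].
HB.instance Definition _ := [Choice of Z2loc by <:].
HB.instance Definition _ := [SubChoice_isSubComNzRing of Z2loc by <:].

Definition ku := {poly Z2loc}.
HB.instance Definition _ := GRing.ComNzRing.on ku.

Definition u : ku := 'X.

Section Span.
Variables (R : nzRingType) (V : lmodType R) (S : V -> Prop).

Definition span_of : {pred V} :=
  fun x => `[< exists (n : nat) (a : 'I_n -> R) (v : 'I_n -> V),
                 (forall i, S (v i)) /\ x = \sum_(i < n) a i *: v i >].

Lemma span_of_submod_closed : GRing.submod_closed span_of.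
Proof.
split=> [|c x y /asboolP[n [a [v [Sv ->]]]] /asboolP[m [b [w [Sw ->]]]]].
  apply/asboolP; exists 0%N, (fun=> 0), (fun=> 0).
  by split=> [[]|] //; rewrite big_ord0.
apply/asboolP; exists (n + m)%N.
exists (fun i => match split i with inl j => c * a j | inr j => b j end).
exists (fun i => match split i with inl j => v j | inr j => w j end).
split=> [i|]; first by case: (split i).
rewrite big_split_ord scaler_sumr /=; congr (_ + _); apply: eq_bigr => i _.
  by rewrite (unsplitK (inl i)) scalerA.
by rewrite (unsplitK (inr i)).
Qed.

HB.instance Definition _ :=
  GRing.isSubmodClosed.Build R V span_of span_of_submod_closed.

(* The library quotients an lmodType by a subgroup only as a zmodType; the
   scalar action on the quotient by a submodule is added here. *)
Definition quot_span := Quotient.quot span_of.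
HB.instance Definition _ := GRing.Zmodule.on quot_span.

Definition quot_span_pi (x : V) : quot_span := \pi_(Quotient.quot span_of) x.

Lemma quot_span_piB x y : quot_span_pi (x - y) = quot_span_pi x - quot_span_pi y.
Proof. exact: raddfB. Qed.

Lemma quot_span_piD x y : quot_span_pi (x + y) = quot_span_pi x + quot_span_pi y.
Proof. exact: raddfD. Qed.

Lemma quot_span_piK (q : quot_span) : quot_span_pi (repr q) = q.
Proof. exact: reprK. Qed.

Lemma quot_span_pi_eq x y :
  (quot_span_pi x == quot_span_pi y) = (x - y \in span_of).
Proof. by rewrite Quotient.idealrBE. Qed.

Lemma quot_span_pi_eq0 x : (quot_span_pi x == 0) = (x \in span_of).
Proof.
have -> : 0 = quot_span_pi 0 :> quot_span by rewrite -(subrr (0 : V)) quot_span_piB subrr.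
by rewrite quot_span_pi_eq subr0.
Qed.

Definition quot_span_scale (a : R) (q : quot_span) : quot_span :=
  quot_span_pi (a *: repr q).

Lemma quot_span_scale_pi a x :
  quot_span_scale a (quot_span_pi x) = quot_span_pi (a *: x).
Proof.
apply/eqP; rewrite quot_span_pi_eq -scalerBr rpredZ //.
by rewrite -quot_span_pi_eq quot_span_piK.
Qed.

Fact quot_span_scalerA a b q :
  quot_span_scale a (quot_span_scale b q) = quot_span_scale (a * b) q.
Proof. by rewrite -(quot_span_piK q) !quot_span_scale_pi scalerA. Qed.

Fact quot_span_scale1r : left_id 1 quot_span_scale.
Proof. by move=> q; rewrite -(quot_span_piK q) quot_span_scale_pi scale1r. Qed.

Fact quot_span_scalerDr : right_distributive quot_span_scale +%R.
Proof.
move=> a q r; rewrite -(quot_span_piK q) -(quot_span_piK r).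
by rewrite -quot_span_piD !quot_span_scale_pi scalerDr quot_span_piD.
Qed.

Fact quot_span_scalerDl q : {morph quot_span_scale^~ q : a b / a + b}.
Proof.
move=> a b; rewrite -(quot_span_piK q) !quot_span_scale_pi.
by rewrite scalerDl quot_span_piD.
Qed.

HB.instance Definition _ := GRing.Zmodule_isLmodule.Build R quot_span
  quot_span_scalerA quot_span_scale1r quot_span_scalerDr quot_span_scalerDl.

End Span.

Definition annihilator (R : nzRingType) (V : lmodType R) (x : V) : R -> Prop :=
  fun a => a *: x = 0.

Definition ideal_gen (R : comNzRingType) (s : seq R) : R -> Prop :=
  fun x => exists c : 'I_(size s) -> R, x = \sum_(k < size s) c k * s`_k.

(* The grading (|u| = 2, |[i,j]| = 2i + 2j) is left implicit: all relations are
   homogeneous, and the underlying module determines the annihilator. *)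
Section LensTensor.
Variable e : nat.

Definition free_ij : lmodType ku := {malg ku[(nat * nat)%type]}.

Definition gen (i j : nat) : free_ij := << (i, j) >>.

Definition rel_left (i j : nat) : free_ij :=
  \sum_(l < i.+1) ('C(2 ^ e, l.+1)%:R * u ^+ l) *: gen (i - l) j.

Definition rel_right (i j : nat) : free_ij :=
  \sum_(l < j.+1) ('C(2 ^ e, l.+1)%:R * u ^+ l) *: gen i (j - l).

Definition is_rel (x : free_ij) : Prop :=
  exists i j, x = rel_left i j \/ x = rel_right i j.

Definition M_ : lmodType ku := quot_span is_rel.

(* The class [i,j]. *)
Definition cls (i j : nat) : M_ := quot_span_pi is_rel (gen i j).

(* k.-1 and the subtraction of 2 never truncate, since 1 <= k <= e. *)
Definition I_gens : seq ku :=
  2 ^+ e ::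
  [seq 2 ^+ (e - k) * u ^+ (3 * 2 ^ k.-1 - 2) | k <- iota 1 e].

End LensTensor.

(* Main.v *)
Require Import Defs.
From HB Require Import structures.
From mathcomp Require Import all_boot all_order all_algebra all_field finmap.
From mathcomp Require Import boolp monalg.
From mathcomp Require Import ring zify.

Set Implicit Arguments.
Unset Strict Implicit.
Unset Printing Implicit Defensive.

Import GRing.Theory Num.Theory.
Local Open Scope ring_scope.

(** Let N(t) = ((1 + t)^(2^e) - 1) / t, and let x and y act on the free module by
    [i,j] -> u[i-1,j] and [i,j] -> u[i,j-1], with [i,j] = 0 for negative i or j.
    The defining relations are the elements N(x)[i,j] and N(y)[i,j], and an
    element of J^d, for J = (x, y) in Z[x,y], acts as a multiple of u^d.

    Everything rests on one identity, for each k < e, where K = 2^k: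
      g N(y) - h N(x) = R   in Z[x,y],
    with g(0,0) = K, with R in J^(3K-2), and with an odd multiple of 2^(e-k-1)
    as coefficient of x^(K-1) y^(2K-1) in R ([rect_pair_exists]).

    Such an R gives elements of the annihilator: R acts as a relation, and on
    [K-1,2K-1] all of its terms but that one vanish, so 2^(e-k-1) u^(3K-2) [0,0]
    is a relation ([rel_span_gen00]).

    It also shows that there are no others.  If p[0,0] = N(x)A + N(y)B, apply g
    and replace g N(y) by h N(x) + R: modulo u^(3K-2) one gets
    K p [0,0] = N(x) C.  As N(x) is 2^e plus terms that lower the first index,
    comparing the coefficients at [i,0] from the top index down shows that only
    the one of C at [0,0] survives there, so 2^e divides K p_s for every
    s < 3K - 2, where p_s is the coefficient of u^s ([coef_of_rel_span_gen00]).
    These divisibilities for all k < e say exactly that p lies in the ideal.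

    For e = k + 1 put n = 2K, X = 1 + x, Y = 1 + y, and take for R the product
    of the 3K - 2 elements Y - X^c (0 < c < n) and X - Y^(2i) (0 < i < K) of J.
    They correspond to the points of the projective line over Z/n other than
    the two axes.  If z and w are nontrivial n-th roots of unity, one of them is
    a power of the other, so a factor vanishes at (X,Y) = (z,w).  Hence R and
    g N(y) - h N(x) agree there, and it remains to choose g and h that give the
    right values on the axes: a polynomial that vanishes at all pairs of n-th
    roots of unity lies in the ideal (x N(x), y N(y)) ([grid_ideal]), and this
    error is absorbed by g and h ([rect_line_prod]).

    From e to e + 1, both N(x) and N(y) get a new factor that is 2 modulo J and
    even except for one term of degree 2^e.  The new identity is the product of
    the old one with the two factors, divided by 2; the quotient is integral up
    to J^(3K-1) because g and h are even below degree K - 1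
    ([rect_pair_double]). *)

(** * Orders of vanishing in Z[x,y] *)

(** The outer variable is y and the inner one is x: [p`_j`_i] is the coefficient
    of x^i y^j. *)
Notation bipoly := {poly {poly int}}.

(** Membership in the d-th power of the ideal (x, y). *)
Definition ordge (d : nat) (p : bipoly) : Prop :=
  forall i j, (i + j < d)%N -> p`_j`_i = 0.

Lemma ordgeW d d' p : (d <= d')%N -> ordge d' p -> ordge d p.
Proof. by move=> le_dd' pP i j ij; apply: pP; apply: leq_trans le_dd'. Qed.

Lemma ordgeD d p q : ordge d p -> ordge d q -> ordge d (p + q).
Proof. by move=> pP qP i j ij; rewrite !coefD pP // qP // addr0. Qed.

Lemma ordgeN d p : ordge d p -> ordge d (- p).
Proof. by move=> pP i j ij; rewrite !coefN pP // oppr0. Qed.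

Lemma ordgeB d p q : ordge d p -> ordge d q -> ordge d (p - q).
Proof. by move=> pP qP; apply/ordgeD/ordgeN. Qed.

Lemma ordgeM d d' p q : ordge d p -> ordge d' q -> ordge (d + d') (p * q).
Proof.
move=> pP qP i j ij; rewrite coefM coef_sum big1 // => -[b /= ltb] _.
rewrite coefM big1 // => -[a /= lta] _.
have [lt_ab|le_ab] := ltnP (a + b) d; first by rewrite pP // mul0r.
by rewrite qP ?mulr0 //; lia.
Qed.

Lemma ordgeMl d p q : ordge d q -> ordge d (p * q).
Proof. by move=> qP; rewrite -[d]add0n; apply: ordgeM. Qed.

Lemma ordgeMr d p q : ordge d p -> ordge d (p * q).
Proof. by move=> pP; rewrite mulrC; apply: ordgeMl. Qed.

Lemma ordge1 (p : bipoly) : p`_0`_0 = 0 -> ordge 1 p.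
Proof. by move=> p0 [|i] [|j]. Qed.

Lemma ordge_prod (F : nat -> bipoly) m n :
  (forall i, ordge 1 (F i)) -> ordge (n - m) (\prod_(m <= i < n) F i).
Proof.
move=> FP; have [lt_mn|le_nm] := ltnP m n; last first.
  by have -> : (n - m)%N = 0%N by lia.
rewrite -(subnKC (ltnW lt_mn)) addKn; elim: (n - m)%N => // d IHd.
rewrite addnS big_nat_recr ?leq_addr //= -addn1.
exact: ordgeM.
Qed.

(** Multiplication by a series with constant term c acts as c on initial forms. *)
Lemma coef_initialM d (p q : bipoly) i j :
  ordge d q -> (i + j <= d)%N -> (p * q)`_j`_i = p`_0`_0 * q`_j`_i.
Proof.
move=> qP ij; rewrite -{1}[p](subrK (p`_0`_0)%:P%:P) mulrDl !coefD.
rewrite (_ : ((p - _) * q)`_j`_i = 0) ?add0r ?coefCM //.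
have: ordge 1 (p - (p`_0`_0)%:P%:P) by apply: ordge1; rewrite !coefB !coefC /= subrr.
by move=> /ordgeM /(_ qP); apply; rewrite add1n ltnS.
Qed.

Definition inX (p : {poly int}) : bipoly := p%:P.
Definition inY (p : {poly int}) : bipoly := map_poly polyC p.

Lemma inXD p q : inX (p + q) = inX p + inX q. Proof. exact: rmorphD. Qed.
Lemma inXM p q : inX (p * q) = inX p * inX q. Proof. exact: rmorphM. Qed.
Lemma inX2 p : inX (2 * p) = 2 * inX p. Proof. by rewrite inXM /inX rmorph_nat. Qed.
Lemma inYD p q : inY (p + q) = inY p + inY q. Proof. exact: rmorphD. Qed.
Lemma inYM p q : inY (p * q) = inY p * inY q. Proof. exact: rmorphM. Qed.
Lemma inY2 p : inY (2 * p) = 2 * inY p. Proof. by rewrite inYM /inY rmorph_nat. Qed.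

Lemma inY_coef p j : (inY p)`_j = (p`_j)%:P.
Proof. by rewrite coef_map_id0. Qed.

(** * The series of the relations *)

(** This is ((1 + t)^n - 1) / t; see [X_qpoly]. *)
Definition qpoly (n : nat) : {poly int} := \poly_(l < n) 'C(n, l.+1)%:R.

Lemma qpoly_coef n l : (qpoly n)`_l = 'C(n, l.+1)%:R.
Proof. by rewrite coef_poly; case: ltnP => // le_nl; rewrite bin_small // ltnS. Qed.

Lemma X_qpoly n : 'X * qpoly n = (1 + 'X) ^+ n - 1.
Proof.
apply/polyP => i; rewrite coefXM coefB coef1 (addrC 1) exprD1n coef_sum qpoly_coef.
under eq_bigr => l _ do rewrite coefMn coefXn.
case: i => [|i] /=.
  rewrite (bigD1 ord0) //= big1 ?addr0 ?bin0 ?subrr //.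
  by case=> [[|l] ltl] //= _; rewrite mul0rn.
rewrite subr0; have [lt_in|le_ni] := ltnP i.+1 n.+1.
  rewrite (bigD1 (Ordinal lt_in)) //= eqxx big1 ?addr0 //.
  by case=> l ltl; rewrite -val_eqE eq_sym /= => /negPf->; rewrite mul0rn.
rewrite bin_small // big1 // => -[l ltl] _ /=.
by rewrite gtn_eqF ?mul0rn // (leq_trans ltl).
Qed.

(** The Frobenius congruence, kept as an equation over the integers so that it
    can be halved later. *)
Lemma expr_pow2_mod2 (R : comNzRingType) (t : R) e :
  exists w, (1 + t) ^+ (2 ^ e) = 1 + t ^+ (2 ^ e) + 2 * w.
Proof.
elim: e => [|e [w IHe]]; first by exists 0; rewrite !expr1 mulr0 addr0.
rewrite expnS mulnC !exprM IHe; set s := t ^+ _.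
by exists (s + 2 * w * (1 + s) + 2 * w ^+ 2); ring.
Qed.

(** The error of the Frobenius congruence has no constant term; this makes the
    quotients by 2 taken below equal to 1 modulo J. *)
Lemma onePX_pow2 e : exists w : {poly int},
  (1 + 'X) ^+ (2 ^ e) = 1 + 'X ^+ (2 ^ e) + 2 * ('X * w).
Proof.
have [w wE] := expr_pow2_mod2 ('X : {poly int}) e.
have: root w 0.
  have /(congr1 (fun p => p.[0])) := wE.
  rewrite !hornerE expr1n expr0n expn_eq0 /=.
  by rewrite addr0 -[LHS]addr0 => /addrI/esym/eqP; rewrite mulf_eq0.
by move=> /factor_theorem[v vE]; exists v; rewrite wE vE subr0 (mulrC v).
Qed.

Lemma qpoly_pow2S e : qpoly (2 ^ e.+1) = qpoly (2 ^ e) * (1 + (1 + 'X) ^+ (2 ^ e)).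
Proof.
apply: (mulfI (negbT (polyX_eq0 _))); rewrite mulrA !X_qpoly expnS mulnC exprM.
by ring.
Qed.

(** * The basic identity and its propagation in e *)

(** Evenness of all coefficients of degree less than d, phrased as a
    decomposition so that p can be divided by 2 up to J^d. *)
Definition even_below (d : nat) (p : bipoly) : Prop :=
  exists p1 p2, p = 2 * p1 + p2 /\ ordge d p2.

Lemma coef2M (p : bipoly) i j : (2 * p)`_j`_i = 2 * p`_j`_i.
Proof. by rewrite !mulr_natl !coefMn. Qed.

Lemma even_belowP d (p : bipoly) :
  (forall i j, (i + j < d)%N -> exists c, p`_j`_i = 2 * c) -> even_below d p.
Proof.
pose half (c : int) := (c %/ 2)%Z; have half0 : half 0 = 0 by rewrite /half div0z.
move=> pP; pose p1 := map_poly (map_poly half) p.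
have p1E i j : p1`_j`_i = half p`_j`_i.
  by rewrite !coef_map_id0 ?map_poly0.
exists p1, (p - 2 * p1); split=> [|i j /pP[c cE]]; first by rewrite addrC subrK.
by rewrite !coefB coef2M p1E cE /half mulKz // subrr.
Qed.

Lemma ordge_Xn_inX n : ordge n (inX 'X^n).
Proof.
move=> i [|j] ij; rewrite coefC //= ?coef0 // coefXn.
by case: eqP => // iE; lia.
Qed.

Lemma ordge_Xn_inY n : ordge n (inY 'X^n).
Proof.
move=> i j ij; rewrite inY_coef coefXn; case: eqP => [jE|_]; first by lia.
by rewrite coef0.
Qed.

(** In group-ring terms, with X = 1 + x and Y = 1 + y, the simplest candidate for
    g N(y) - h N(x) is the sum of X^i Y^j over a K by n rectangle minus the sum
    over the transposed one.  The evenness of g and h below degree K - 1 is what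
    lets the identity pass from n to 2n. *)
Record rect_pair (K : nat) (n : nat) (c : int) (g h : bipoly) : Prop := RectPair {
  rp_g_even : even_below K.-1 g;
  rp_h_even : even_below K.-1 h;
  rp_ord : ordge (3 * K - 2) (g * inY (qpoly n) - h * inX (qpoly n));
  rp_const : g`_0`_0 = K%:Z;
  rp_coef : (g * inY (qpoly n) - h * inX (qpoly n))`_(2 * K - 1)`_(K - 1) = c
}.

(** Write phi = 1 + (1 + t)^E = 2 v + t^E for the new factor, and g = 2 g1 + g2
    with g2 in J^(K-1).  Then g phi(x) is twice g v + g1 x^E, up to g2 x^E, which
    lies in J^(K-1+E) and hence in J^(3K-1).  So half of the product of the old
    identity with phi(x) phi(y), a factor 4 modulo J, is again an identity of
    the same shape. *)
Lemma rect_pair_double K e c g h : (0 < K)%N -> (2 * K <= 2 ^ e)%N ->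
  rect_pair K (2 ^ e) c g h -> exists g' h', rect_pair K (2 ^ e.+1) (2 * c) g' h'.
Proof.
move=> K_gt0 leKE [[g1 [g2 [gE g2P]]] [h1 [h2 [hE h2P]]] RP g00 Rc].
set E := (2 ^ e)%N in leKE *.
have [v v0 phiE] : exists2 v : {poly int}, v`_0 = 1 & 1 + (1 + 'X) ^+ E = 2 * v + 'X^E.
  have [w wE] := onePX_pow2 e; exists (1 + 'X * w); last by rewrite wE; ring.
  by rewrite coefD coef1 coefXM addr0.
pose g' := g * inX v + g1 * inX 'X^E; pose h' := h * inY v + h1 * inY 'X^E.
have NE : qpoly (2 ^ e.+1) = qpoly E * (2 * v + 'X^E) by rewrite -phiE qpoly_pow2S.
have ordXE := @ordge_Xn_inX E; have ordYE := @ordge_Xn_inY E.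
pose R := g * inY (qpoly E) - h * inX (qpoly E).
pose R' := g' * inY (qpoly (2 ^ e.+1)) - h' * inX (qpoly (2 ^ e.+1)).
pose phi := inX (2 * v + 'X^E) * inY (2 * v + 'X^E).
pose D := g2 * inX 'X^E * inY (qpoly (2 ^ e.+1)) - h2 * inY 'X^E * inX (qpoly (2 ^ e.+1)).
(* D collects the parts of g and h that cannot be halved; it is too deep in J
   to influence the coefficients of degree at most 3K - 2. *)
have R'E : 2 * R' = phi * R - D.
  rewrite /R' /D /R /phi NE /g' /h' !inXM !inYM !inXD !inYD !inX2 !inY2.
  move: (inX v) (inY v) (inX 'X^E) (inY 'X^E) (inX _) (inY _) => vx vy xE yE Nx Ny.
  by rewrite gE hE; ring.
have DP : ordge (3 * K - 1) D.
  by apply: ordgeB; apply: ordgeMr; apply: ordgeW (ordgeM _ _); eauto; lia.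
have phi00 : phi`_0`_0 = 4.
  rewrite /phi coefM big_ord1 coefM big_ord1 /= inY_coef !coefC /= coefD.
  rewrite mulr_natl coefMn v0 coefXn; case: eqP => // E0.
  by move: K_gt0 leKE; rewrite -E0; lia.
have Rcoef i j : (i + j <= 3 * K - 2)%N -> R'`_j`_i = 2 * R`_j`_i.
  have RP' : ordge (3 * K - 2) R := RP.
  move=> ij; clearbody R R' phi D; have := congr1 (fun p : bipoly => p`_j`_i) R'E.
  rewrite coef2M !coefB (@coef_initialM (3 * K - 2) phi R i j RP' ij) DP ?phi00; last by lia.
  by lia.
exists g', h'; split.
- exists (g1 * inX v), (g2 * inX v + g1 * inX 'X^E); split.
    by rewrite /g' gE; ring.
  apply: ordgeD; first exact: ordgeMr.
  by apply: ordgeW (ordgeMl _ ordXE); lia.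
- exists (h1 * inY v), (h2 * inY v + h1 * inY 'X^E); split.
    by rewrite /h' hE; ring.
  apply: ordgeD; first exact: ordgeMr.
  by apply: ordgeW (ordgeMl _ ordYE); lia.
- move=> i j ij; rewrite -/R' Rcoef 1?ltnW // RP // mulr0.
- rewrite !coefD !coefM !big_ord1 /= !coefM !big_ord1 /= !coefC /= v0 g00.
  by rewrite coefXn; case: eqP => [E0|_]; [lia | rewrite mulr0 addr0 mulr1].
- by rewrite -/R' Rcoef ?Rc //; lia.
Qed.

(** * Evaluation at pairs of roots of unity *)
Definition aeval (z : algC) (p : {poly int}) : algC := (map_poly intr p).[z].
HB.instance Definition _ z :=
  GRing.RMorphism.copy (aeval z) (horner_eval z \o map_poly (intr : int -> algC)).

Definition beval (z w : algC) (p : bipoly) : algC := (map_poly (aeval z) p).[w].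
HB.instance Definition _ z w :=
  GRing.RMorphism.copy (beval z w) (horner_eval w \o map_poly (aeval z)).

Lemma beval_inX z w p : beval z w (inX p) = aeval z p.
Proof. by rewrite /beval map_polyC hornerC. Qed.

Lemma beval_inY z w p : beval z w (inY p) = aeval w p.
Proof.
rewrite /beval /inY -map_poly_comp; congr _.[_]; apply: eq_map_poly => c /=.
by rewrite /aeval map_polyC hornerC.
Qed.

Lemma aevalX z : aeval z 'X = z.
Proof. by rewrite /aeval map_polyX hornerX. Qed.

Lemma aeval0 p : aeval 0 p = (p`_0)%:~R.
Proof. by rewrite /aeval horner_coef0 coef_map. Qed.

Lemma monic_dvd_of_roots (f p : {poly int}) (rs : seq algC) :
  f \is monic -> size f = (size rs).+1 -> uniq rs ->
  {in rs, forall z, aeval z f = 0} -> {in rs, forall z, aeval z p = 0} ->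
  p = Pdiv.Ring.rdivp p f * f.
Proof.
move=> f_mon szf rs_uniq f0 p0.
have := Pdiv.RingMonic.rdivp_eq f_mon p.
set q := Pdiv.Ring.rdivp p f; set r := Pdiv.Ring.rmodp p f => pE.
rewrite {1}pE; suff -> : r = 0 by rewrite addr0.
apply: (map_inj_poly (intr_inj : injective (intr : int -> algC))); rewrite ?rmorph0 //.
apply: (@roots_geq_poly_eq0 _ _ rs) => //.
  apply/allP => z zrs; rewrite rootE -/(aeval z r).
  by have := p0 z zrs; rewrite pE rmorphD rmorphM /= f0 // mulr0 add0r => ->.
rewrite size_map_inj_poly ?rmorph0 //; last exact: intr_inj.
by rewrite -ltnS -szf Pdiv.Ring.ltn_rmodp monic_neq0.
Qed.

(** Divide p by f(y), then the coefficients of the remainder by f(x).  At each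
    root z for x, the first remainder is a polynomial in y with more roots than
    its degree allows; so each of its coefficients vanishes at all roots of f. *)
Lemma grid_ideal (f : {poly int}) (p : bipoly) (rs : seq algC) :
  f \is monic -> size f = (size rs).+1 -> uniq rs ->
  {in rs, forall z, aeval z f = 0} ->
  {in rs &, forall z w, beval z w p = 0} ->
  exists a b, p = a * inX f + b * inY f.
Proof.
move=> f_mon szf rs_uniq f0 p0.
have F_mon : inY f \is monic by exact: monic_map.
have szF : size (inY f) = size f.
  by rewrite /inY size_map_inj_poly // => a b /polyC_inj.
have := Pdiv.RingMonic.rdivp_eq F_mon p.
set b := Pdiv.Ring.rdivp p _; set r := Pdiv.Ring.rmodp p _ => pE.
have szr : (size r <= size rs)%N.
  by rewrite -ltnS -szf -szF Pdiv.Ring.ltn_rmodp monic_neq0.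
have r0 z j : z \in rs -> aeval z r`_j = 0.
  move=> zrs; have <- : (map_poly (aeval z) r)`_j = aeval z r`_j.
    by rewrite coef_map_id0 ?rmorph0.
  suff -> : map_poly (aeval z) r = 0 by rewrite coef0.
  apply: (@roots_geq_poly_eq0 _ _ rs) => //.
    apply/allP => w wrs; rewrite rootE -/(beval z w r).
    have := p0 z w zrs wrs.
    by rewrite pE rmorphD rmorphM /= beval_inY f0 // mulr0 add0r => ->.
  by apply: leq_trans szr; apply: size_poly.
exists (\poly_(j < size r) Pdiv.Ring.rdivp r`_j f), b.
rewrite {1}pE addrC; congr (_ + _); apply/polyP => j.
rewrite coefMC coef_poly; case: ltnP => [_|szj]; last by rewrite nth_default ?mul0r.
by apply: monic_dvd_of_roots (r0^~ j).
Qed.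

(** The quotient of t^n - 1 by t - 1, evaluated at 1 in two ways. *)
Lemma prim_root_prod1B n (z : algC) : (0 < n)%N -> n.-primitive_root z ->
  \prod_(1 <= c < n) (1 - z ^+ c) = n%:R.
Proof.
case: n => // n _ z_prim; have := factor_Xn_sub_1 z_prim.
rewrite big_nat_recl // expr0 polyC1 subrX1.
have X1_neq0 : 'X - 1 != 0 :> {poly algC} by rewrite polyXsubC_eq0.
move=> /(mulfI X1_neq0)/(congr1 (fun p => p.[1])).
rewrite big_add1 /= horner_prod horner_sum.
under eq_bigr => i _ do rewrite hornerXsubC.
move=> ->; under eq_bigr => i _ do rewrite hornerXn expr1n.
by rewrite sumr_const card_ord.
Qed.

(** In a cyclic 2-group, of any two elements one is a power of the other.  The
    exponent in the second alternative can be taken even, since an odd one would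
    be invertible and lead back to the first. *)
Lemma pow2_residue_multiple m s t : (0 < s < 2 ^ m)%N -> (0 < t < 2 ^ m)%N ->
  (exists2 c, (0 < c < 2 ^ m)%N & t = s * c %[mod 2 ^ m]) \/
  (exists2 i, (0 < i < 2 ^ m.-1)%N & s = t * (2 * i) %[mod 2 ^ m]).
Proof.
move=> s_lt t_lt; set n := (2 ^ m)%N in s_lt t_lt *.
have n_gt0 : (0 < n)%N by rewrite expn_gt0.
have solve a b : (0 < a)%N -> (0 < b < n)%N -> (gcdn a n %| b)%N ->
    exists2 c, (0 < c < n)%N & b = a * c %[mod n].
  move=> a_gt0 /andP[b_gt0 b_lt] /dvdnP[q bE].
  have [ka kn kE _] := egcdnP n a_gt0.
  have bc : b = a * (ka * q %% n) %[mod n].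
    by rewrite modnMmr mulnA (mulnC a) kE mulnDl -mulnA mulnCA -modnDml modnMr add0n bE mulnC.
  exists (ka * q %% n)%N => //; rewrite ltn_mod n_gt0 andbT lt0n.
  by apply: contraTneq b_gt0 => c0; move: bc; rewrite c0 muln0 mod0n modn_small // => ->.
have [s_gt0 t_gt0] : (0 < s)%N /\ (0 < t)%N by case/andP: s_lt; case/andP: t_lt.
have [dvd_st|ndvd_st] := boolP (gcdn s n %| t)%N.
  by left; apply: solve.
right; have /(dvdn_pfactor _ _ (isT : prime 2))[i _ iE] := dvdn_gcdr s n.
have /(dvdn_pfactor _ _ (isT : prime 2))[j _ jE] := dvdn_gcdr t n.
have le_ji : (j <= i)%N.
  apply: contraR ndvd_st; rewrite -ltnNge => lt_ij.
  by apply: dvdn_trans (dvdn_gcdl t n); rewrite iE jE dvdn_exp2l // ltnW.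
have dvd_ts : (gcdn t n %| s)%N.
  by apply: dvdn_trans (dvdn_gcdl s n); rewrite iE jE dvdn_exp2l.
have [c /andP[c_gt0 c_lt] sE] := solve t s t_gt0 s_lt dvd_ts.
have c_even : ~~ odd c.
  apply: contra ndvd_st => c_odd.
  rewrite -gcdn_modl sE gcdn_modl gcdnC mulnC Gauss_gcdr ?dvdn_gcdr //.
  by rewrite /n coprimeXl // prime_coprime // dvdn2 c_odd.
have m_gt0 : (0 < m)%N by rewrite lt0n; apply: contraTneq c_lt => m0; rewrite /n m0 -leqNgt.
have nE : n = (2 * 2 ^ m.-1)%N by rewrite -expnS prednK.
have cE := odd_double_half c; rewrite (negbTE c_even) add0n -mul2n in cE.
exists c./2; last by rewrite cE.
lia.
Qed.

(** * The product of lines *)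
Definition line_prod (k : nat) : bipoly :=
  (\prod_(1 <= c < 2 ^ k.+1) (inY (1 + 'X) - inX (1 + 'X) ^+ c))
  * \prod_(1 <= i < 2 ^ k) (inX (1 + 'X) - inY (1 + 'X) ^+ (2 * i)).

Lemma ordge_line_prod k : ordge (3 * 2 ^ k - 2) (line_prod k).
Proof.
have oX : ordge 1 (inX (1 + 'X) - 1).
  by rewrite inXD addrC addKr; apply: (@ordge_Xn_inX 1).
have oY : ordge 1 (inY (1 + 'X) - 1).
  by rewrite inYD {1}/inY rmorph1 addrC addKr; apply: (@ordge_Xn_inY 1).
have powB (p : bipoly) c : ordge 1 (p - 1) -> ordge 1 (p ^+ c - 1).
  by move=> pP; rewrite subrX1; apply: ordgeMr.
have diff (p q : bipoly) c : ordge 1 (p - 1) -> ordge 1 (q - 1) -> ordge 1 (p - q ^+ c).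
  move=> pP qP; have -> : p - q ^+ c = (p - 1) - (q ^+ c - 1) by ring.
  by apply: ordgeB => //; apply: powB.
apply: (@ordgeW _ (2 ^ k.+1 - 1 + (2 ^ k - 1))); first by rewrite expnS; lia.
by apply: ordgeM; apply: ordge_prod => c; apply: diff.
Qed.

(** Modulo the ideal generated by x N(x) and y N(y), an element is determined by
    its values at pairs of roots of unity.  On the axis Y = 1 the product of lines
    vanishes except at primitive roots z = X, where it is n (z - 1)^(K-1), while
    X_K := ((1 + x)^K - 1) / x takes the value -2 / (z - 1).  As z^K = -1, the
    polynomial mu equals -(z - 1)^K / 2 there, so mu X_K has the value wanted
    for g.  On the other axis the same computation calls for mu^2 Y_K. *)
Section LineProdValues.
Variables (k : nat) (mu : {poly int}) (om : algC).
Let K := (2 ^ k)%N.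
Let n := (2 ^ k.+1)%N.
Hypothesis muE : 2 * mu = (1 + 'X) ^+ K + 1 - 'X^K.
Hypothesis mu0 : mu`_0 = 1.
Hypothesis om_prim : n.-primitive_root om.

Let nE : n = (2 * K)%N. Proof. exact: expnS. Qed.
Let K_gt0 : (0 < K)%N. Proof. by rewrite expn_gt0. Qed.

Let rect : bipoly :=
  inX (mu * qpoly K) * inY (qpoly n) - inY (mu ^+ 2 * qpoly K) * inX (qpoly n).

Let aeval_1X z : aeval (z - 1) (1 + 'X) = z.
Proof. by rewrite rmorphD rmorph1 /= aevalX addrC subrK. Qed.

Let aeval_qpoly z m : (z - 1) * aeval (z - 1) (qpoly m) = z ^+ m - 1.
Proof.
by rewrite -{1}[z - 1]aevalX -rmorphM X_qpoly rmorphB rmorph1 rmorphXn /= aeval_1X.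
Qed.

Let aeval_mu z : 2 * aeval (z - 1) mu = z ^+ K + 1 - (z - 1) ^+ K.
Proof.
have := congr1 (aeval (z - 1)) muE.
by rewrite rmorphB rmorphD rmorphM !rmorphXn rmorph1 rmorph_nat /= aeval_1X aevalX.
Qed.

Let omX_eq1 s : (om ^+ s == 1) = (n %| s)%N.
Proof. by rewrite (prim_order_dvd om_prim). Qed.

Let om_neq0 s : (0 < s < n)%N -> om ^+ s - 1 != 0.
Proof. by move=> s_lt; rewrite subr_eq0 omX_eq1; apply/negP => /dvdn_leq; lia. Qed.

Let aeval_qpoly_root s m : (0 < s < n)%N -> (n %| s * m)%N ->
  aeval (om ^+ s - 1) (qpoly m) = 0.
Proof.
move=> s_lt dvd_n; apply: (mulfI (om_neq0 s_lt)).
by rewrite aeval_qpoly mulr0 -exprM; apply/eqP; rewrite subr_eq0 omX_eq1.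
Qed.

Let dvd_nK s : (n %| s * K)%N = ~~ odd s.
Proof. by rewrite nE dvdn_pmul2r // dvdn2. Qed.

(* om ^+ s is primitive, so its K-th power is the square root -1 of 1. *)
Let omK s : odd s -> (om ^+ s) ^+ K = -1.
Proof.
move=> s_odd; have /eqP : (om ^+ s) ^+ K ^+ 2 = 1.
  by rewrite -!exprM; apply/eqP; rewrite omX_eq1 nE; apply/dvdnP; exists s; lia.
rewrite -subr_eq0 subr_sqr_1 mulf_eq0 subr_eq0 addr_eq0 => /orP[|/eqP//].
by rewrite -exprM omX_eq1 dvd_nK s_odd.
Qed.

Let beval_line_prod s t : beval (om ^+ s - 1) (om ^+ t - 1) (line_prod k) =
  (\prod_(1 <= c < n) (om ^+ t - om ^+ s ^+ c))
  * \prod_(1 <= i < K) (om ^+ s - om ^+ t ^+ (2 * i)).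
Proof.
rewrite rmorphM !rmorph_prod /=; congr (_ * _); apply: eq_bigr => i _;
by rewrite rmorphB rmorphXn /= beval_inX beval_inY !aeval_1X.
Qed.

Let prod_eq0 (F : nat -> algC) m i : (0 < i < m)%N -> F i = 0 -> \prod_(1 <= c < m) F c = 0.
Proof.
move=> i_lt Fi0; rewrite (big_cat_nat (n := i)) //=; [|lia|lia].
by rewrite [X in _ * X]big_ltn ?Fi0 ?mul0r ?mulr0 //; lia.
Qed.

Let line_prod_generic s t : (0 < s < n)%N -> (0 < t < n)%N ->
  beval (om ^+ s - 1) (om ^+ t - 1) (line_prod k) = 0.
Proof.
move=> s_lt t_lt; rewrite beval_line_prod.
have [[c c_lt tE]|[i i_lt sE]] := pow2_residue_multiple s_lt t_lt.
  rewrite (prod_eq0 c_lt) ?mul0r // -exprM; apply/eqP.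
  by rewrite subr_eq0 (eq_prim_root_expr om_prim) tE.
rewrite [X in _ * X](prod_eq0 i_lt) ?mulr0 // -exprM; apply/eqP.
by rewrite subr_eq0 (eq_prim_root_expr om_prim) sE.
Qed.

Let line_prod_x s : (0 < s < n)%N ->
  beval (om ^+ s - 1) 0 (line_prod k) = aeval (om ^+ s - 1) (mu * qpoly K) * n%:R.
Proof.
move=> s_lt; have z_neq0 := om_neq0 s_lt.
rewrite -(subrr 1) -{2}(expr0 om) beval_line_prod expr0.
have [s_odd|s_even] := boolP (odd s); last first.
  rewrite (@prod_eq0 _ _ K) ?mul0r; last 2 first.
  - by rewrite nE; lia.
  - by apply/eqP; rewrite subr_eq0 eq_sym -exprM omX_eq1 dvd_nK.
  by rewrite rmorphM /= aeval_qpoly_root ?dvd_nK // mulr0 mul0r.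
rewrite prim_root_prod1B ?expn_gt0 //; last first.
  by rewrite prim_root_exp_coprime // coprimeXr // coprimen2.
under eq_bigr => i _ do rewrite expr1n.
rewrite prodr_const_nat mulrC; congr (_ * _).
rewrite rmorphM /=; apply: (mulfI z_neq0).
rewrite mulrCA aeval_qpoly omK // -exprS -subSn // subSS subn0.
have := aeval_mu (om ^+ s); rewrite omK // addNr sub0r => muE'.
by rewrite -[LHS]opprK -muE'; ring.
Qed.

Let line_prod_y t : (0 < t < n)%N ->
  beval 0 (om ^+ t - 1) (line_prod k) = - (aeval (om ^+ t - 1) (mu ^+ 2 * qpoly K) * n%:R).
Proof.
move=> t_lt; have z_neq0 := om_neq0 t_lt.
rewrite -{1}(subrr 1) -{1}(expr0 om) beval_line_prod expr0.
have [t_odd|t_even] := boolP (odd t); last first.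
  rewrite [X in _ * X](@prod_eq0 _ _ K./2) ?mulr0; last 2 first.
  - by lia.
  - have -> : (2 * K./2 = K)%N.
      rewrite mul2n halfK; move: t_lt t_even; rewrite nE /K.
      by case: (k) => [|k'] //; [lia | rewrite oddX subn0].
    by apply/eqP; rewrite subr_eq0 eq_sym -exprM omX_eq1 dvd_nK.
  by rewrite rmorphM /= aeval_qpoly_root ?dvd_nK // mulr0 mul0r oppr0.
under eq_bigr => i _ do rewrite expr1n.
rewrite prodr_const_nat.
under [X in _ * X]eq_bigr => i _ do rewrite exprM.
rewrite prim_root_prod1B //; last first.
  have := exp_prim_root om_prim (t * 2); rewrite exprM (_ : (n %/ _ = K)%N) //.
  rewrite nE (mulnC t) -muln_gcdr (eqP (_ : coprime t K)) ?coprimeXr ?coprimen2 //.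
  by rewrite muln1 mulKn.
have := aeval_mu (om ^+ t); rewrite omK // addNr sub0r => muE'.
have two_neq0 : 2 != 0 :> algC by rewrite pnatr_eq0.
apply: (mulfI two_neq0); apply: (mulfI z_neq0).
rewrite [LHS](_ : _ = (om ^+ t - 1) ^+ n * n%:R); last first.
  rewrite nE natrM; have -> : (2 * K = (2 * K - 1).+1)%N by lia.
  by rewrite subSS subn0 exprS; ring.
rewrite nE [in LHS]mulnC exprM -[(om ^+ t - 1) ^+ K]opprK -muE'.
have -> : aeval (om ^+ t - 1) (mu ^+ 2 * qpoly K) =
    aeval (om ^+ t - 1) mu ^+ 2 * aeval (om ^+ t - 1) (qpoly K).
  by rewrite rmorphM /= rmorphXn.
rewrite [RHS](_ : _ = - (2 * aeval (om ^+ t - 1) mu ^+ 2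
  * ((om ^+ t - 1) * aeval (om ^+ t - 1) (qpoly K)) * (2 * K)%:R)); last by ring.
by rewrite aeval_qpoly omK //; ring.
Qed.

Lemma beval_rect_line_prod s t : (s < n)%N -> (t < n)%N ->
  beval (om ^+ s - 1) (om ^+ t - 1) (rect - line_prod k) = 0.
Proof.
move=> s_lt t_lt; rewrite rmorphB /=.
have -> z w : beval z w rect = aeval z (mu * qpoly K) * aeval w (qpoly n)
    - aeval w (mu ^+ 2 * qpoly K) * aeval z (qpoly n).
  by rewrite rmorphB /=; congr (_ - _); rewrite rmorphM /= beval_inX beval_inY.
have qn_root i : (0 < i < n)%N -> aeval (om ^+ i - 1) (qpoly n) = 0.
  by move=> i_lt; rewrite aeval_qpoly_root ?dvdn_mull.
have q0 m : aeval 0 (qpoly m) = m%:R by rewrite aeval0 qpoly_coef bin1 rmorph_nat.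
have om00 : om ^+ 0 - 1 = 0 by rewrite expr0 subrr.
have [-> {s s_lt}|s_gt0] := posnP s; have [-> {t t_lt}|t_gt0] := posnP t.
- rewrite beval_line_prod (@prod_eq0 _ _ 1) ?expr0 ?expr1n ?subrr //; last by rewrite nE; lia.
  rewrite mul0r subr0 !rmorphM /= !q0 !aeval0 mu0.
  by rewrite !mul1r subrr.
- have t_lt' : (0 < t < n)%N by rewrite t_gt0.
  by rewrite om00 line_prod_y // qn_root // q0 mulr0 sub0r subrr.
- have s_lt' : (0 < s < n)%N by rewrite s_gt0.
  by rewrite om00 line_prod_x // qn_root // q0 mulr0 subr0 subrr.
- by rewrite line_prod_generic ?qn_root ?s_gt0 ?t_gt0 // !mulr0 !subrr.
Qed.
End LineProdValues.

Lemma rect_line_prod k (mu : {poly int}) : let K := (2 ^ k)%N in let n := (2 ^ k.+1)%N in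
  2 * mu = (1 + 'X) ^+ K + 1 - 'X^K -> mu`_0 = 1 ->
  exists a b, (inX (mu * qpoly K) - b * inY 'X) * inY (qpoly n)
    - (inY (mu ^+ 2 * qpoly K) + a * inX 'X) * inX (qpoly n) = line_prod k.
Proof.
move=> K n muE mu0; have n_gt0 : (0 < n)%N by rewrite expn_gt0.
have [om om_prim] := C_prim_root_exists n_gt0.
pose rs := [seq om ^+ i - 1 | i <- iota 0 n].
have pow_mon : (1 + 'X) ^+ n \is @monic int.
  by rewrite addrC monic_exp // monicXaddC.
have pow_size : size ((1 + 'X) ^+ n : {poly int}) = n.+1.
  by have := size_exp_XsubC n (-1 : int); rewrite polyCN opprK addrC.
have fE := X_qpoly n; set f := 'X * qpoly n in fE.
have size1 : (size (- 1 : {poly int})%R < size ((1 + 'X) ^+ n : {poly int})%R)%N.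
  by rewrite size_polyN size_poly1 pow_size.
have [||||z w|a [b abE]] := @grid_ideal f
    (inX (mu * qpoly K) * inY (qpoly n) - inY (mu ^+ 2 * qpoly K) * inX (qpoly n)
     - line_prod k) rs.
- by rewrite fE monicE lead_coefDl // -monicE.
- by rewrite fE size_polyDl // pow_size size_map size_iota.
- rewrite map_inj_in_uniq ?iota_uniq // => i j; rewrite !mem_iota => i_lt j_lt.
  move=> /addIr/eqP; rewrite (eq_prim_root_expr om_prim) !modn_small //.
  by move/eqP.
- move=> z /mapP[i _ ->]; rewrite fE rmorphB rmorph1 rmorphXn rmorphD rmorph1 /= aevalX.
  by rewrite [1 + _]addrC subrK -exprM mulnC exprM (prim_expr_order om_prim) expr1n subrr.
- move=> /mapP[i i_lt ->] /mapP[j j_lt ->]; move: i_lt j_lt; rewrite !mem_iota => i_lt j_lt.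
  exact: beval_rect_line_prod.
exists a, b; rewrite (inXM 'X) (inYM 'X) in abE.
move: abE; set A := inX (mu * _); set B := inY (mu ^+ 2 * _) => abE.
have -> : line_prod k = A * inY (qpoly n) - B * inX (qpoly n)
    - (a * (inX 'X * inX (qpoly n)) + b * (inY 'X * inY (qpoly n))).
  by rewrite -abE; ring.
by ring.
Qed.

(** This determines g, h and R modulo 2: there g y^(n-1) - h x^(n-1) = R. *)
Lemma qpoly_pow2_mod2 e : exists w, qpoly (2 ^ e) = 'X^(2 ^ e - 1) + 2 * w.
Proof.
have [w wE] := onePX_pow2 e; exists w.
apply: (mulfI (negbT (polyX_eq0 _))); rewrite X_qpoly wE mulrDr -exprS.
by rewrite -subSn ?expn_gt0 // subSS subn0; ring.
Qed.

(** Everything that is not visible from the construction is read off modulo 2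
    from g y^(n-1) - h x^(n-1) = R: below degree K - 1 the coefficients of g and h
    appear in R in degrees less than 3K - 2, hence are even, and the coefficient
    of x^(K-1) y^(2K-1) in R is that of x^(K-1) in g, which is odd because
    modulo 2 the pure x-part of g is mu x^(K-1), where mu(0) = 1. *)
Lemma rect_pair_base k : exists c g h, rect_pair (2 ^ k) (2 ^ k.+1) (1 + 2 * c) g h.
Proof.
set K := (2 ^ k)%N; set n := (2 ^ k.+1)%N.
have K_gt0 : (0 < K)%N by rewrite expn_gt0.
have nE : n = (2 * K)%N by exact: expnS.
have [v vE] := onePX_pow2 k; pose mu := 1 + 'X * v.
have mu0 : mu`_0 = 1 by rewrite coefD coef1 coefXM addr0.
have [|a [b abE]] := @rect_line_prod k mu _ mu0.
  by rewrite vE /mu; ring.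
move: abE; set g := inX _ - _; set h := inY _ + _ => RE.
have [w wE] := qpoly_pow2_mod2 k.+1; rewrite -/n in wE.
have RP := @ordge_line_prod k; rewrite -/K in RP.
have coefN (p q : bipoly) i j : (p * inY (qpoly n) - q * inX (qpoly n))`_j`_i =
    (if (j < n - 1)%N then 0 else p`_(j - (n - 1))`_i)
    - (if (i < n - 1)%N then 0 else q`_j`_(i - (n - 1)))
    + 2 * (p * inY w - q * inX w)`_j`_i.
  have -> : p * inY (qpoly n) - q * inX (qpoly n) =
      p * 'X^(n - 1) - q * inX 'X^(n - 1) + 2 * (p * inY w - q * inX w).
    by rewrite wE inXD inYD inX2 inY2 [inY 'X^_]rmorphXn /= /inY map_polyX; ring.
  move: (p * inY w - _) => D; rewrite !coefD !coefN coef2M coefMXn coefMC coefMXn.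
  by case: (j < n - 1)%N; rewrite ?coef0.
have Rij i j : (i + j < 3 * K - 2)%N -> (g * inY (qpoly n) - h * inX (qpoly n))`_j`_i = 0.
  by move=> ij; rewrite RE RP.
have g0j i : g`_0`_i = (mu * qpoly K)`_i.
  by rewrite coefB /inY map_polyX coefMX subr0 coefC.
have [ltN ltS] : (K - 1 < n - 1)%N /\ (forall i j, i + j < K.-1 ->
    [/\ i < n - 1, j < n - 1, i + (j + (n - 1)) < 3 * K - 2 & i + (n - 1) + j < 3 * K - 2])%N.
  by move: (n) (K) K_gt0 nE => n' K' K'_gt0 ->; split=> [|i j ij]; [lia | split; lia].
clearbody g h; have [w' w'E] := qpoly_pow2_mod2 k; rewrite -/K in w'E.
exists ((mu * w')`_(K - 1) + (g * inY w - h * inX w)`_(2 * K - 1)`_(K - 1)), g, h; split.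
- apply: even_belowP => i j /ltS[ltin ltjn ltij ltij']; have := Rij i (j + (n - 1))%N.
  rewrite coefN [(j + _ < _)%N]ltnNge leq_addl /= addnK ltin.
  move: (g * inY w - _) => D dE; exists (- D`_(j + (n - 1))`_i).
  by have /eqP := dE ltij; rewrite subr0 addr_eq0 mulrN => /eqP.
- apply: even_belowP => i j /ltS[ltin ltjn ltij ltij']; have := Rij (i + (n - 1))%N j.
  rewrite coefN [(i + _ < _)%N]ltnNge leq_addl /= addnK ltjn.
  move: (g * inY w - _) => D dE; exists D`_j`_(i + (n - 1)).
  by have /eqP := dE ltij'; rewrite sub0r addrC subr_eq0 => /eqP.
- by rewrite RE.
- by rewrite g0j coefM big_ord1 subn0 mu0 mul1r qpoly_coef bin1 natz.
- rewrite coefN -nE ltnn subnn ltN subr0.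
  rewrite g0j w'E mulrDr coefD coefMXn ltnn subnn mu0 mulrCA.
  have -> (p : {poly int}) i : (2 * p)`_i = 2 * p`_i by rewrite !mulr_natl coefMn.
  by rewrite (mulrDr 2) addrA.
Qed.

Lemma rect_pair_exists k t :
  exists c g h, rect_pair (2 ^ k) (2 ^ (k.+1 + t)) (2 ^+ t * (1 + 2 * c)) g h.
Proof.
have [c base] := rect_pair_base k; exists c.
elim: t => [|t [g [h IHt]]]; first by rewrite addn0 expr0 mul1r.
rewrite addnS exprS -mulrA; apply: rect_pair_double IHt; first by rewrite expn_gt0.
by rewrite -expnS leq_exp2l // leq_addr.
Qed.

(** * Module structures over polynomial rings *)
Lemma linear_zero (k : comNzRingType) (V W : lmodType k) (h : V -> W) :
  (forall c v w, h (c *: v + w) = c *: h v + h w) -> h 0 = 0.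
Proof. by move=> hP; have := hP (-1) 0 0; rewrite scaleN1r oppr0 addr0 scaleN1r addNr. Qed.

Lemma linear_scale (k : comNzRingType) (V W : lmodType k) (h : V -> W) c v :
  (forall c v w, h (c *: v + w) = c *: h v + h w) -> h (c *: v) = c *: h v.
Proof.
by move=> hP; have := hP c v 0; rewrite (linear_zero hP) !addr0.
Qed.

Section LinearExtension.
Variables (W : lmodType ku) (F : nat * nat -> W).

Definition lext (v : free_ij) : W := \sum_(k <- msupp v) v@_k *: F k.

Lemma lextEw (d : {fset nat * nat}) v :
  (msupp v `<=` d)%fset -> lext v = \sum_(k <- d) v@_k *: F k.
Proof.
move=> le_vd; rewrite /lext; apply: big_fset_incl => // k _.
by move=> /mcoeff_outdom->; rewrite scale0r.
Qed.

Lemma lextP (c : ku) (v w : free_ij) : lext (c *: v + w) = c *: lext v + lext w.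
Proof.
pose d := (msupp v `|` msupp w `|` msupp (c *: v + w))%fset.
have sub_d : [/\ msupp v `<=` d, msupp w `<=` d & msupp (c *: v + w) `<=` d]%fset.
  by rewrite /d; split; apply/fsubsetP => k; rewrite !inE => ->; rewrite ?orbT.
case: sub_d => dv dw dvw; rewrite (lextEw dv) (lextEw dw) (lextEw dvw).
rewrite scaler_sumr -big_split /=; apply: eq_bigr => k _.
by rewrite mcoeffD mcoeffZ scalerDl scalerA.
Qed.

Lemma lext_gen i j : lext (gen i j) = F (i, j).
Proof.
by rewrite /lext /gen msuppU oner_eq0 big_seq_fset1 mcoeffUU scale1r.
Qed.

End LinearExtension.

(** Ring actions by linear maps, as a predicate: the same carrier receives in turn
    actions of Z, Z[x] and Z[x,y]. *)
Record is_action (k R : comNzRingType) (V : lmodType k) (rho : R -> V -> V) : Prop :=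
  IsAction {
    act_linear : forall a c v w, rho a (c *: v + w) = c *: rho a v + rho a w;
    actD : forall a b v, rho (a + b) v = rho a v + rho b v;
    actM : forall a b v, rho (a * b) v = rho a (rho b v);
    act1 : forall v, rho 1 v = v
  }.

Section PolyAction.
Variables (k R : comNzRingType) (V : lmodType k) (rho : R -> V -> V) (f : V -> V).
Hypotheses (rhoP : is_action rho)
  (f_linear : forall c v w, f (c *: v + w) = c *: f v + f w)
  (f_rho : forall a v, f (rho a v) = rho a (f v)).

Definition poly_act (p : {poly R}) (v : V) : V :=
  \sum_(i < size p) rho p`_i (iter i f v).

Let linD (h : V -> V) : (forall c v w, h (c *: v + w) = c *: h v + h w) ->
  forall v w, h (v + w) = h v + h w.
Proof. by move=> hP v w; have := hP 1 v w; rewrite !scale1r. Qed.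

Let linsum (h : V -> V) n (G : 'I_n -> V) :
  (forall c v w, h (c *: v + w) = c *: h v + h w) ->
  h (\sum_i G i) = \sum_i h (G i).
Proof. by move=> hP; apply: big_morph; [apply: linD | apply: linear_zero]. Qed.

Let rho0 v : rho 0 v = 0.
Proof. by apply: (addIr (rho 0 v)); rewrite add0r -(actD rhoP) addr0. Qed.

Lemma iter_linear n c v w : iter n f (c *: v + w) = c *: iter n f v + iter n f w.
Proof. by elim: n => //= n ->. Qed.

Lemma poly_actE n (p : {poly R}) v :
  (size p <= n)%N -> poly_act p v = \sum_(i < n) rho p`_i (iter i f v).
Proof.
move=> szp; rewrite /poly_act (big_ord_widen n (fun i => rho p`_i (iter i f v))) //.
rewrite big_mkcond /=; apply: eq_bigr => i _; case: ltnP => // le_pi.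
by rewrite nth_default ?rho0.
Qed.

Lemma poly_actC a v : poly_act a%:P v = rho a v.
Proof. by rewrite (@poly_actE 1) ?size_polyC_leq1 // big_ord1 coefC. Qed.

Lemma poly_actD p q v : poly_act (p + q) v = poly_act p v + poly_act q v.
Proof.
rewrite !(@poly_actE (maxn (size p) (size q))) ?leq_maxl ?leq_maxr ?size_polyD //.
by rewrite -big_split; apply: eq_bigr => i _; rewrite coefD (actD rhoP).
Qed.

Lemma poly_actZ a p v : poly_act (a%:P * p) v = rho a (poly_act p v).
Proof.
rewrite (@poly_actE (size p)); last first.
  by rewrite mul_polyC size_scale_leq.
rewrite linsum; last by move=> *; apply: act_linear.
by apply: eq_bigr => i _; rewrite coefCM (actM rhoP).
Qed.

(** The number of terms depends on v here, and not on p; this is the form in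
    which the defining relations are written. *)
Lemma poly_act_nilp n p v :
  iter n f v = 0 -> poly_act p v = \sum_(i < n) rho p`_i (iter i f v).
Proof.
move=> fn0; have f0 : f 0 = 0 by apply: linear_zero.
have rho_0 a : rho a 0 = 0 by apply: linear_zero; apply: act_linear.
rewrite (@poly_actE (n + size p)) ?leq_addl // big_split_ord /= addrC big1 ?add0r // => i _.
by rewrite [(n + i)%N]addnC iterD fn0 iter_fix ?rho_0.
Qed.

Lemma poly_act_comm (h : V -> V) p v : (forall c v w, h (c *: v + w) = c *: h v + h w) ->
  (forall a v, h (rho a v) = rho a (h v)) -> (forall v, h (f v) = f (h v)) ->
  h (poly_act p v) = poly_act p (h v).
Proof.
move=> h_linear h_rho h_f; rewrite linsum //; apply: eq_bigr => i _; rewrite h_rho.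
by congr (rho _ _); elim: (nat_of_ord i) => //= m IHm; rewrite h_f IHm.
Qed.

Lemma poly_actMX p v : poly_act (p * 'X) v = poly_act p (f v).
Proof.
rewrite (@poly_actE (size p).+1); last first.
  by have [->|p0] := eqVneq p 0; rewrite ?mul0r ?size_poly0 // size_mulX.
rewrite big_ord_recl coefMX /= rho0 add0r; apply: eq_bigr => i _.
by rewrite coefMX /= -iterSr.
Qed.

Lemma poly_act_is_action : is_action poly_act.
Proof.
split=> [p c v w|p q v|p q v|v]; first last.
- by rewrite poly_actC (act1 rhoP).
- elim/poly_ind: p => [|p a IHp] in v *.
    by rewrite mul0r -polyC0 !poly_actC !rho0.
  by rewrite mulrDl -mulrA (mulrC 'X) mulrA !poly_actD !poly_actMX IHp poly_actZ
             poly_actC (@poly_act_comm f).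
- exact: poly_actD.
- rewrite /poly_act scaler_sumr -big_split; apply: eq_bigr => i _ /=.
  by rewrite iter_linear (act_linear rhoP).
Qed.

End PolyAction.

(** * The action of Z[x,y] on the free module *)
Definition int_act (c : int) (v : free_ij) : free_ij := (c%:~R : ku) *: v.

Lemma int_act_is_action : is_action int_act.
Proof.
split=> [a c v w|a b v|a b v|v]; rewrite /int_act.
- by rewrite scalerDr !scalerA mulrC.
- by rewrite rmorphD scalerDl.
- by rewrite rmorphM scalerA.
- by rewrite scale1r.
Qed.

Definition shiftX : free_ij -> free_ij :=
  lext (fun k => if k.1 is i.+1 then gen i k.2 else 0).
Definition shiftY : free_ij -> free_ij :=
  lext (fun k => if k.2 is j.+1 then gen k.1 j else 0).

Lemma linear_int_act (h : free_ij -> free_ij) a v :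
  (forall c v w, h (c *: v + w) = c *: h v + h w) -> h (int_act a v) = int_act a (h v).
Proof. exact: linear_scale. Qed.

(** The factor u makes the operators homogeneous of degree 0, so that the powers
    of u in the relations are produced by the action. *)
Definition xop (v : free_ij) : free_ij := u *: shiftX v.
Definition yop (v : free_ij) : free_ij := u *: shiftY v.

Lemma xop_linear c v w : xop (c *: v + w) = c *: xop v + xop w.
Proof. by rewrite /xop /shiftX lextP scalerDr !scalerA mulrC. Qed.

Lemma yop_linear c v w : yop (c *: v + w) = c *: yop v + yop w.
Proof. by rewrite /yop /shiftY lextP scalerDr !scalerA mulrC. Qed.

Lemma coef_shiftX v i j : (shiftX v)@_(i, j) = v@_(i.+1, j).
Proof.
rewrite /shiftX (@lextEw _ _ ((i.+1, j) |` msupp v)%fset); last exact: fsubsetUr.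
rewrite raddf_sum (big_fsetD1 (i.+1, j)) /=; last by rewrite !inE eqxx.
rewrite mcoeffZ /gen mcoeffUU mulr1 big1_fset ?addr0 // => -[[|a] b] /=.
  by rewrite scaler0 mcoeff0.
rewrite !inE => /andP[neq _] _; rewrite mcoeffZ mcoeffU.
by move: neq; rewrite !xpair_eqE eqSS => /negPf->; rewrite mulr0.
Qed.

Lemma coef_shiftY v i j : (shiftY v)@_(i, j) = v@_(i, j.+1).
Proof.
rewrite /shiftY (@lextEw _ _ ((i, j.+1) |` msupp v)%fset); last exact: fsubsetUr.
rewrite raddf_sum (big_fsetD1 (i, j.+1)) /=; last by rewrite !inE eqxx.
rewrite mcoeffZ /gen mcoeffUU mulr1 big1_fset ?addr0 // => -[a [|b]] /=.
  by rewrite scaler0 mcoeff0.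
rewrite !inE => /andP[neq _] _; rewrite mcoeffZ mcoeffU.
by move: neq; rewrite !xpair_eqE eqSS => /negPf->; rewrite mulr0.
Qed.

Lemma coef_xop v i j : (xop v)@_(i, j) = u * v@_(i.+1, j).
Proof. by rewrite -coef_shiftX -mcoeffZ. Qed.

Lemma coef_yop v i j : (yop v)@_(i, j) = u * v@_(i, j.+1).
Proof. by rewrite -coef_shiftY -mcoeffZ. Qed.

Lemma yop_xop v : yop (xop v) = xop (yop v).
Proof.
apply: (proj1 (malgP _ _)) => -[i j].
by rewrite [LHS]coef_yop [in LHS]coef_xop [RHS]coef_xop [in RHS]coef_yop.
Qed.

Definition actX : {poly int} -> free_ij -> free_ij := poly_act int_act xop.
Definition act : bipoly -> free_ij -> free_ij := poly_act actX yop.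

Lemma actX_is_action : is_action actX.
Proof.
apply: poly_act_is_action; [exact: int_act_is_action | exact: xop_linear |].
by move=> a v; apply: linear_int_act xop_linear.
Qed.

Lemma yop_actX p v : yop (actX p v) = actX p (yop v).
Proof.
apply: poly_act_comm; [exact: yop_linear | | exact: yop_xop].
by move=> a w; apply: linear_int_act yop_linear.
Qed.

Lemma act_is_action : is_action act.
Proof. exact: poly_act_is_action actX_is_action yop_linear yop_actX. Qed.

Lemma xop_gen i j : xop (gen i j) = if i is i'.+1 then u *: gen i' j else 0.
Proof. by rewrite /xop /shiftX lext_gen; case: i => [|i] //; rewrite scaler0. Qed.

Lemma yop_gen i j : yop (gen i j) = if j is j'.+1 then u *: gen i j' else 0.
Proof. by rewrite /yop /shiftY lext_gen; case: j => [|j] //; rewrite scaler0. Qed.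

Lemma iter_xop_gen l i j :
  iter l xop (gen i j) = if (l <= i)%N then u ^+ l *: gen (i - l) j else 0.
Proof.
elim: l => [|l IHl]; first by rewrite /= subn0 scale1r.
rewrite iterS IHl; case: ltnP => [lt_li|le_il].
  rewrite ltnW // (linear_scale _ _ xop_linear) xop_gen subnS.
  by rewrite -(prednK (_ : (0 < i - l)%N)) ?subn_gt0 //= scalerA -exprSr.
case: ifP => [le_li|_]; last exact: linear_zero xop_linear.
by rewrite (linear_scale _ _ xop_linear) xop_gen (_ : (i - l)%N = 0%N) ?scaler0 //; lia.
Qed.

Lemma iter_yop_gen l i j :
  iter l yop (gen i j) = if (l <= j)%N then u ^+ l *: gen i (j - l) else 0.
Proof.
elim: l => [|l IHl]; first by rewrite /= subn0 scale1r.
rewrite iterS IHl; case: ltnP => [lt_li|le_il].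
  rewrite ltnW // (linear_scale _ _ yop_linear) yop_gen subnS.
  by rewrite -(prednK (_ : (0 < j - l)%N)) ?subn_gt0 //= scalerA -exprSr.
case: ifP => [le_li|_]; last exact: linear_zero yop_linear.
by rewrite (linear_scale _ _ yop_linear) yop_gen (_ : (j - l)%N = 0%N) ?scaler0 //; lia.
Qed.

Lemma actX_gen p i j :
  actX p (gen i j) = \sum_(l < i.+1) ((p`_l)%:~R * u ^+ l) *: gen (i - l) j.
Proof.
rewrite /actX (poly_act_nilp int_act_is_action xop_linear (n := i.+1)); last first.
  by rewrite iter_xop_gen ltnn.
by apply: eq_bigr => l _; rewrite iter_xop_gen -ltnS ltn_ord /int_act scalerA.
Qed.

Lemma act_gen P i j :
  act P (gen i j) = \sum_(m < j.+1) u ^+ m *: actX P`_m (gen i (j - m)).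
Proof.
rewrite /act (poly_act_nilp actX_is_action yop_linear (n := j.+1)); last first.
  by rewrite iter_yop_gen ltnn.
apply: eq_bigr => l _; rewrite iter_yop_gen -ltnS ltn_ord.
exact: linear_scale (act_linear actX_is_action _).
Qed.

Lemma act_inX p v : act (inX p) v = actX p v.
Proof. by rewrite /act /inX (poly_actC _ actX_is_action). Qed.

Lemma rel_leftE e i j : act (inX (qpoly (2 ^ e))) (gen i j) = rel_left e i j.
Proof.
rewrite act_inX actX_gen; apply: eq_bigr => l _.
by rewrite qpoly_coef rmorph_nat.
Qed.

Lemma rel_rightE e i j : act (inY (qpoly (2 ^ e))) (gen i j) = rel_right e i j.
Proof.
rewrite act_gen; apply: eq_bigr => l _; rewrite inY_coef.
rewrite /actX (poly_actC _ int_act_is_action) /int_act scalerA mulrC.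
by rewrite qpoly_coef rmorph_nat.
Qed.

Lemma coef_iter_xop l v i j : (iter l xop v)@_(i, j) = u ^+ l * v@_((i + l)%N, j).
Proof.
elim: l i => [|l IHl] i /=; first by rewrite addn0 mul1r.
by rewrite coef_xop IHl mulrA -exprS addSnnS.
Qed.

Lemma coef_actX n (q : {poly int}) (v : free_ij) i j : (size q <= n)%N ->
  (actX q v)@_(i, j) = \sum_(l < n) (q`_l)%:~R * (u ^+ l * v@_((i + l)%N, j)).
Proof.
move=> szq; rewrite /actX (poly_actE _ int_act_is_action _ szq) raddf_sum.
by apply: eq_bigr => l _; rewrite /= mcoeffZ coef_iter_xop.
Qed.

Definition udvd (d : nat) (v : free_ij) : Prop := exists w, v = u ^+ d *: w.

Lemma udvd_sum d n (F : 'I_n -> free_ij) : (forall i, udvd d (F i)) -> udvd d (\sum_i F i).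
Proof.
move=> FP; apply: (big_ind (udvd d)) => [|_ _ [v ->] [w ->]|i _] //.
  by exists 0; rewrite scaler0.
by exists (v + w); rewrite scalerDr.
Qed.

Lemma iter_xop_shift i v : iter i xop v = u ^+ i *: iter i shiftX v.
Proof.
elim: i => [|i IHi]; first by rewrite scale1r.
by rewrite iterS IHi (linear_scale _ _ xop_linear) exprSr -scalerA.
Qed.

Lemma iter_yop_shift i v : iter i yop v = u ^+ i *: iter i shiftY v.
Proof.
elim: i => [|i IHi]; first by rewrite scale1r.
by rewrite iterS IHi (linear_scale _ _ yop_linear) exprSr -scalerA.
Qed.

Lemma iter_xop_yop i j v :
  iter i xop (iter j yop v) = u ^+ (i + j) *: iter i shiftX (iter j shiftY v).
Proof.
rewrite iter_yop_shift; move: (iter j shiftY v) => w.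
rewrite (linear_scale _ _ (iter_linear xop_linear i)) iter_xop_shift.
by rewrite scalerA -exprD addnC.
Qed.

Lemma udvd_scale d n c v : (d <= n)%N -> udvd d (c *: (u ^+ n *: v)).
Proof.
move=> le_dn; exists ((c * u ^+ (n - d)) *: v).
by rewrite !scalerA mulrCA -exprD subnKC.
Qed.

Lemma udvd_act d P v : ordge d P -> udvd d (act P v).
Proof.
move=> PP; apply: udvd_sum => j; apply: udvd_sum => i; rewrite /int_act.
have [lt_d|le_d] := ltnP (i + j) d; last by rewrite iter_xop_yop; apply: udvd_scale.
by rewrite PP // scale0r; exists 0; rewrite scaler0.
Qed.

(** [a,b] has degree a + b in the generators, so of an element of J^(a+b) only the
    monomial x^a y^b survives on it. *)
Lemma act_gen_initial P a b : ordge (a + b) P ->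
  act P (gen a b) = ((P`_b`_a)%:~R * u ^+ (a + b)) *: gen 0 0.
Proof.
move=> PP; rewrite act_gen big_ord_recr big1 /= => [|m _]; last first.
  rewrite actX_gen big1 ?scaler0 // => l _; rewrite PP ?mul0r ?scale0r //.
  by rewrite -addnS leq_add // -ltnS.
rewrite add0r subnn actX_gen big_ord_recr big1 /= => [|l _]; last first.
  by rewrite PP ?mul0r ?scale0r // ltn_add2r.
by rewrite add0r subnn scalerA mulrCA -exprD addnC.
Qed.

Lemma free_ij_ind (Q : free_ij -> Prop) :
  Q 0 -> (forall c v w, Q v -> Q w -> Q (c *: v + w)) -> (forall i j, Q (gen i j)) ->
  forall v, Q v.
Proof.
move=> Q0 Qlin Qgen v; rewrite (monalgE v).
elim: (enum_fset _) => [|[i j] s IHs]; first by rewrite big_nil.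
rewrite big_cons (_ : << _ *g _ >> = v@_(i, j) *: gen i j); first exact: Qlin.
apply: (proj1 (malgP _ _)) => k; rewrite mcoeffZ /gen !mcoeffU.
by rewrite -mulr_natr -[in RHS]mulr_natr mul1r.
Qed.

(** * Relations *)
Section Relations.
Variable e : nat.
Let Nx := inX (qpoly (2 ^ e)).
Let Ny := inY (qpoly (2 ^ e)).

(** Together with [act_rel_span]: the submodule of relations is the image of the
    ideal generated by N(x) and N(y). *)
Lemma rel_span_actE v : v \in span_of (is_rel e) -> exists A B, v = act Nx A + act Ny B.
Proof.
move=> /asboolP[n [a [w [wP ->]]]].
have actL P := act_linear act_is_action P.
have act0 P : act P 0 = 0 by apply: linear_zero (actL P).
elim: n => [|n IHn] in a w wP *.
  by exists 0, 0; rewrite big_ord0 !act0 addr0.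
rewrite big_ord_recl.
have [A [B ->]] := IHn (fun i => a (lift ord0 i)) _ (fun i => wP (lift ord0 i)).
have [i [j [->|->]]] := wP ord0.
  by exists (a ord0 *: gen i j + A), B; rewrite actL /Nx rel_leftE addrA.
by exists A, (a ord0 *: gen i j + B); rewrite actL {2}/Ny rel_rightE addrCA.
Qed.

Lemma act_rel_span A B : act Nx A + act Ny B \in span_of (is_rel e).
Proof.
have actL P := act_linear act_is_action P.
have rel_span v : is_rel e v -> v \in span_of (is_rel e).
  move=> vP; apply/asboolP; exists 1%N, (fun=> 1), (fun=> v).
  by rewrite big_ord1 scale1r.
apply: rpredD.
  elim/free_ij_ind: A => [|c v w vP wP|i j]; first by rewrite (linear_zero (actL Nx)) rpred0.
    by rewrite actL rpredD // rpredZ.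
  by apply: rel_span; exists i, j; left; rewrite rel_leftE.
elim/free_ij_ind: B => [|c v w vP wP|i j]; first by rewrite (linear_zero (actL Ny)) rpred0.
  by rewrite actL rpredD // rpredZ.
by apply: rel_span; exists i, j; right; rewrite rel_rightE.
Qed.

End Relations.

(** * The annihilator of the generator in degree zero *)
Lemma natr_Z2loc_inj n (a b : Z2loc) : (0 < n)%N -> n%:R * a = n%:R * b -> a = b.
Proof.
move=> n_gt0 /(congr1 val); rewrite !rmorphM !rmorph_nat => /mulfI eqab.
by apply: val_inj; apply: eqab; rewrite pnatr_eq0 -lt0n.
Qed.

Lemma odd_inv (c : int) : exists d : Z2loc, (1 + 2 * c)%:~R * d = 1.
Proof.
set x : int := 1 + 2 * c.
have x_odd : odd `|x|%N by rewrite /x; lia.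
have x_neq0 : x%:~R != 0 :> rat by rewrite intr_eq0 -absz_gt0 odd_gt0.
have inv_odd : (x%:~R^-1 : rat) \in odd_den.
  apply/odd_denP; exists `|x|%N, (sgz x); split=> //.
  apply: (mulfI x_neq0); rewrite mulrA divff // mul1r -rmorphM /=.
  by rewrite -[LHS]/((`|x|%N : int)%:~R) abszEsg mulrC.
exists (MkZ2loc inv_odd); apply: val_inj; rewrite rmorphM rmorph_int rmorph1.
exact: divff.
Qed.

(** Here 2^k and k + 1 + t are the K and the e of the basic identity, so
    that t = e - k - 1. *)
Lemma rel_span_gen00 k t :
  (2 ^+ t * u ^+ (3 * 2 ^ k - 2)) *: gen 0 0 \in span_of (is_rel (k.+1 + t)).
Proof.
have [c [g [h [_ _ RP _ Rc]]]] := rect_pair_exists k t.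
have K_gt0 : (0 < 2 ^ k)%N by rewrite expn_gt0.
move: RP Rc; set K := (2 ^ k)%N in K_gt0 *; set e := (k.+1 + t)%N.
set Nx := inX _; set Ny := inY _ => RP Rc.
have K3 : (3 * K - 2 = (K - 1) + (2 * K - 1))%N by lia.
have actP := act_is_action.
pose w := gen (K - 1) (2 * K - 1).
have wE : act Nx (- act h w) + act Ny (act g w)
    = (2 ^+ t * u ^+ (3 * K - 2)) *: ((1 + 2 * c)%:~R *: gen 0 0).
  rewrite -scaleN1r (linear_scale _ _ (act_linear actP _)) scaleN1r -!(actM actP).
  rewrite -{1}[Ny * g](subrK (Nx * h)) (actD actP) addrCA addNr addr0.
  rewrite mulrC [Nx * h]mulrC K3 act_gen_initial -?K3 // Rc scalerA.
  by congr (_ *: _); rewrite rmorphM rmorphXn /= rmorph_nat -!mulrA (mulrC (u ^+ _)).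
have := act_rel_span e (- act h w) (act g w); rewrite -/Nx -/Ny wE.
have [d dE] := odd_inv c => /(rpredZ d%:P); rewrite !scalerA (mulrC d%:P) -[_ * d%:P * _]mulrA.
rewrite (_ : d%:P * (1 + 2 * c)%:~R = 1) ?mulr1 //.
by rewrite -(rmorph_int (@polyC Z2loc)) -rmorphM /= mulrC dE.
Qed.

(** Apply g to p[0,0] = N(x)A + N(y)B to get N(x) C = K p [0,0] modulo u^(3K-2),
    with C = g A + h B.  The coefficients of C at [i,0] for i > 0 vanish modulo
    u^(3K-2): each of them, times 2^e, is a combination of those with larger i. *)
Lemma coef_of_rel_span_gen00 k t (p : ku) :
  p *: gen 0 0 \in span_of (is_rel (k.+1 + t)) ->
  forall s, (s < 3 * 2 ^ k - 2)%N -> exists c, p`_s = 2 ^+ t.+1 * c.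
Proof.
have [c [g [h [_ _ RP g00 _]]]] := rect_pair_exists k t.
have K_gt0 : (0 < 2 ^ k)%N by rewrite expn_gt0.
move: RP g00; set K := (2 ^ k)%N in K_gt0 *; set e := (k.+1 + t)%N.
set Nx := inX _; set Ny := inY _; set d := (3 * K - 2)%N => RP g00.
have actP := act_is_action.
move=> /rel_span_actE[A [B pE]]; rewrite -/Nx -/Ny in pE.
have [D DE] := udvd_act B RP.
pose C := act g A + act h B.
have actDv P v w : act P (v + w) = act P v + act P w.
  by have := act_linear actP P 1 v w; rewrite !scale1r.
have CE : act Nx C = (p * K%:R) *: gen 0 0 - u ^+ d *: D.
  apply/eqP; rewrite eq_sym subr_eq -DE -scalerA.
  have -> : K%:R *: gen 0 0 = act g (gen 0 0).
    by rewrite (act_gen_initial (a := 0) (b := 0)) // g00 mulr1.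
  rewrite -(linear_scale _ _ (act_linear actP _)) pE !actDv -!(actM actP).
  rewrite (mulrC g Nx) -addrA -(actD actP); apply/eqP; congr (_ + act _ _).
  by rewrite (mulrC h) addrC subrK.
have coefC i s : (s < d)%N ->
    \sum_(l < 2 ^ e) 'C(2 ^ e, l.+1)%:R * (u ^+ l * C@_((i + l)%N, 0%N))`_s
    = (if i == 0%N then K%:R * p`_s else 0).
  move=> lt_sd; have := congr1 (fun v : free_ij => (v@_(i, 0%N))`_s) CE.
  rewrite act_inX (coef_actX (n := 2 ^ e)) ?size_poly // coef_sum.
  under eq_bigr => l _ do rewrite qpoly_coef rmorph_nat mulr_natl coefMn -mulr_natl.
  move=> ->; rewrite mcoeffB !mcoeffZ mcoeffU coefB coefXnM lt_sd subr0 xpair_eqE eqxx andbT.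
  case: i => [|i]; last by rewrite mulr0 coef0.
  by rewrite mulr1 mulr_natr coefMn mulr_natl.
(* tail is the part of N(x) C at [i,0] that comes from larger indices. *)
pose tail i s := \sum_(l < (2 ^ e).-1) 'C(2 ^ e, l.+2)%:R * (u ^+ l.+1 * C@_((i + l.+1)%N, 0%N))`_s.
have coefC' i s : (s < d)%N ->
    (2 ^ e)%:R * C@_(i, 0%N)`_s + tail i s = (if i == 0%N then K%:R * p`_s else 0).
  move=> /coefC <-; rewrite -[in RHS](prednK (_ : (0 < 2 ^ e)%N)) ?expn_gt0 //.
  rewrite big_ord_recl /= prednK ?expn_gt0 // addn0 bin1 mul1r; congr (_ + _).
have [N NP] : exists N, forall i, (N <= i)%N -> C@_(i, 0%N) = 0.
  exists (\max_(k <- msupp C) k.1).+1 => i lt_i; apply: mcoeff_outdom.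
  apply: contraL lt_i => supp_i; rewrite -leqNgt.
  exact: (@leq_bigmax_seq _ _ xpredT (fun k : nat * nat => k.1) (i, 0%N)).
have tail0 i : (forall j, (i < j)%N -> forall s, (s < d)%N -> C@_(j, 0%N)`_s = 0) ->
    forall s, (s < d)%N -> tail i s = 0.
  move=> IH s lt_sd; apply: big1 => l _; rewrite coefXnM; case: ifP => _; first by rewrite mulr0.
  by rewrite IH ?mulr0 //; [lia | apply: leq_ltn_trans lt_sd; apply: leq_subr].
have C0 i : (0 < i)%N -> forall s, (s < d)%N -> C@_(i, 0%N)`_s = 0.
  have [n] := ubnP (N - i); elim: n i => // n IHn i lt_n i_gt0 s lt_sd.
  have [le_Ni|lt_iN] := leqP N i; first by rewrite NP // coef0.
  have := coefC' i s lt_sd; rewrite tail0 // => [|j lt_ij]; last by apply: IHn; lia.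
  rewrite gtn_eqF // addr0 -[RHS](mulr0 (2 ^ e)%:R).
  by apply: natr_Z2loc_inj; rewrite expn_gt0.
move=> s lt_sd; exists C@_(0%N, 0%N)`_s.
have := coefC' 0%N s lt_sd; rewrite tail0 // addr0 /= => eqK.
apply: (@natr_Z2loc_inj K) => //; rewrite -eqK mulrA; congr (_ * _).
by rewrite natrX -!natrX -natrM /K -expnD /e addSnnS.
Qed.

Lemma ideal_gen_add (s : seq ku) a b : ideal_gen s a -> ideal_gen s b -> ideal_gen s (a + b).
Proof.
move=> [c ->] [d ->]; exists (fun i => c i + d i).
by rewrite -big_split; apply: eq_bigr => i _; rewrite mulrDl.
Qed.

Lemma ideal_gen_mem (s : seq ku) x a : x \in s -> ideal_gen s (a * x).
Proof.
move=> /(nthP 0)[k lt_k <-]; exists (fun i => if i == Ordinal lt_k then a else 0).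
rewrite (bigD1 (Ordinal lt_k)) //= eqxx big1 ?addr0 // => i /negPf->.
exact: mul0r.
Qed.

Theorem theorem1p6 (e : nat) (he : (1 <= e)%N) (p : ku) :
  annihilator (cls e 0 0) p <-> ideal_gen (I_gens e) p.
Proof.
have annE : annihilator (cls e 0 0) p <-> p *: gen 0 0 \in span_of (is_rel e).
  rewrite /annihilator -[_ *: _]/(quot_span_scale p (cls e 0 0)) quot_span_scale_pi.
  by rewrite -quot_span_pi_eq0; split=> /eqP.
rewrite annE {annE}; split; last first.
  move=> [c ->]; rewrite scaler_suml rpred_sum // => i _; rewrite -scalerA rpredZ //.
  have: (I_gens e)`_i \in I_gens e by rewrite mem_nth.
  rewrite inE => /predU1P[->|/mapP[k]].
    have := act_rel_span e (gen 0 0) 0; rewrite rel_leftE.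
    rewrite (linear_zero (act_linear act_is_action _)).
    by rewrite addr0 /rel_left big_ord1 bin1 mulr1 natrX.
  rewrite mem_iota => k_in ->; have := rel_span_gen00 k.-1 (e - k).
  by rewrite prednK ?subnKC //; lia.
move=> p_ann.
have low k : (0 < k <= e)%N -> forall s, (s < 3 * 2 ^ k.-1 - 2)%N ->
    exists c, p`_s = 2 ^+ (e - k).+1 * c.
  move=> k_in; apply: coef_of_rel_span_gen00; rewrite prednK ?subnKC //; lia.
(* Each monomial of p is treated separately: it is a multiple of the generator
   with the largest k whose power of u divides it, by the divisibility of its
   coefficient that belongs to k + 1. *)
have monomial_mem k s c : (0 < k <= e)%N -> (3 * 2 ^ k.-1 - 2 <= s)%N ->
    p`_s = 2 ^+ (e - k) * c -> ideal_gen (I_gens e) (p`_s *: 'X^s).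
  move=> k_in le_s ->; rewrite -(subnKC le_s) exprD -mul_polyC polyCM rmorphXn rmorph_nat /=.
  rewrite (_ : _ * _ = c%:P * 'X^(s - (3 * 2 ^ k.-1 - 2)) *
    (2 ^+ (e - k) * u ^+ (3 * 2 ^ k.-1 - 2))); last by rewrite /u; ring.
  apply: ideal_gen_mem; rewrite inE; apply/orP; right; apply/mapP; exists k => //.
  by rewrite mem_iota; lia.
rewrite -[p]coefK poly_def; apply: (big_ind (ideal_gen (I_gens e))).
- by rewrite -(mul0r (2 ^+ e : ku)); apply: ideal_gen_mem; apply: mem_head.
- exact: ideal_gen_add.
move=> [s lt_s] _ /=; pose below k := (0 < k <= e)%N && (s < 3 * 2 ^ k.-1 - 2)%N.
have [|ndP] := boolP [exists k : 'I_e.+1, below k]; last first.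
  apply: (monomial_mem e _ p`_s); rewrite ?he ?leqnn // ?subnn ?mul1r // leqNgt.
  apply: contra ndP => lt_e; apply/existsP; exists ord_max.
  by rewrite /below he leqnn.
move=> /existsP[k0 k0P]; have [k /andP[k_in lt_sk] k_min] := ex_minnP (ex_intro below _ k0P).
have [c ps] := low k k_in s lt_sk; have [k1|k_neq1] := eqVneq k 1%N.
  rewrite ps k1 -mul_polyC polyCM rmorphXn rmorph_nat /= -subSn // subSS subn0.
  rewrite (_ : _ * _ = c%:P * 'X^s * (2 ^+ e)); last by ring.
  by apply: ideal_gen_mem; apply: mem_head.
apply: (monomial_mem k.-1 _ c); first by lia.
  by rewrite leqNgt; apply/negP => lt_s'; have := k_min k.-1; rewrite /below lt_s' andbT; lia.
by rewrite ps; congr (2 ^+ _ * _); lia.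
Qed.
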